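(* Let $X$ be a real or complex Banach space. Let $(x_i)\in \ell^{1}(X)$ be such that $\|(x_i)\|=1$, and let $\|x_i\|\neq 0$ for all $i\in\mathbb{N}$. Then $S_{(x_i)}$ is weakly compact in $\ell^{\infty}(X^* )$ if and only if $S_{\frac{x_i}{\|x_i\|}}$ is weakly compact in $X^*$ for each $i\in\mathbb{N}$ and $\operatorname{diam}\left(S_{\frac{x_i}{\|x_i\|}}\right)\to 0$ as $i\to\infty$.
   Context: $\ell^1(X)$ is the Banach space of sequences $(x_i)_{i\in\mathbb{N}}$ in $X$ with $\|(x_i)\|=\sum_{i}\|x_i\|<\infty$. Its dual is identified with $\ell^\infty(X^* )$, the space of bounded sequences $(x_i^* )_{i\in\mathbb{N}}$ in $X^*$ with the supremum norm, via $(x_i^* )((x_i))=\sum_i x_i^*(x_i)$. For a Banach space $E$ with unit sphere $S(E)$ and $e\in S(E)$, the state space of $e$ is $S_e=\{e^*\in S(E^* ):e^*(e)=1\}\subseteq E^*$; $S_{(x_i)}$ is taken with $E=\ell^1(X)$ and $S_{x_i/\|x_i\|}$ with $E=X$. Weakly compact means compact in the weak topology $\sigma(E^*,E^{**})$ of the dual space. $\operatorname{diam}$ is the diameter with respect to the norm of $X^*$. *)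

(* Defs.v *)
From HB Require Import structures.
From mathcomp Require Import all_boot all_order all_algebra.
From mathcomp Require Import ring complex.
From mathcomp Require Import all_classical all_reals all_analysis.
Set Implicit Arguments.
Unset Strict Implicit.
Unset Printing Implicit Defensive.
Import Order.TTheory GRing.Theory Num.Theory.
Import numFieldNormedType.Exports.
Local Open Scope classical_set_scope.
Local Open Scope ring_scope.

Variant scalar_kind := RealScalars | ComplexScalars.

Definition scalars (R : realType) (k : scalar_kind) : numFieldType :=
  match k with RealScalars => R | ComplexScalars => R[i] end.

Section scalar_sup.
Variables (R : realType) (k : scalar_kind).
Local Notation K := (scalars R k).

(* Norms take their values in K, hence in the nonnegative reals of K when
   K = R[i]; there bounded nonempty sets have least upper bounds, so that
   supremum 0 is the usual supremum. *)
Lemma scalars_sup (A : set K) : (forall a, A a -> 0 <= a) -> A !=set0 ->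
  has_ubound A -> isLub A (supremum 0 A).
Proof.
move=> A0 AN0 Aub.
suff [s [sub sle]] : exists s : K, isLub A s.
  rewrite /supremum; case: ifPn => [/eqP AE|_].
    by case: AN0 => a; rewrite AE.
  by case: xgetP => [y _ []//|/(_ s) []]; split.
move: A A0 AN0 Aub; case: k => /= A A0 AN0 Aub.
  have hs : has_sup A by [].
  exists (sup A); split; first exact: sup_upper_bound.
  by move=> b bub; exact: ge_sup.
pose B : set R := [set complex.Re a | a in A].
have AE a : A a -> a = (complex.Re a)%:C%C.
  by move=> /A0; case: a => a b; rewrite lecE /= => /andP[/eqP -> _].
have hs : has_sup B.
  case: AN0 => a Aa; split; first by exists (complex.Re a), a.
  case: Aub => M Mub; exists (complex.Re M) => _ [c Ac <-].
  by have := Mub _ Ac; rewrite lecE => /andP[].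
exists (sup B)%:C%C; split.
  move=> a Aa; rewrite (AE _ Aa) lecR.
  by apply: sup_upper_bound => //; exists a.
move=> b bub; case: AN0 => a Aa.
have bE : b = (complex.Re b)%:C%C.
  have := bub _ Aa; rewrite (AE _ Aa); case: (b) => b1 b2.
  by rewrite lecE /= => /andP[/eqP -> _].
rewrite bE lecR; apply: ge_sup; first by case: hs.
by move=> _ [c Ac <-]; have := bub _ Ac; rewrite lecE => /andP[].
Qed.

Lemma nondecreasing_cvg_sup (u : nat -> K) :
  nondecreasing_seq u -> (forall n, 0 <= u n) -> has_ubound (range u) ->
  u @ \oo --> (supremum 0 (range u) : K).
Proof.
move=> u_nd u0 uub.
have [|||sub sle] := @scalars_sup (range u) => //.
- by move=> _ [n _ <-].
- by exists (u 0%N), 0%N.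
set s := supremum 0 (range u) in sub sle *.
apply/cvgrPdist_lt => e e0.
have us n : u n <= s by apply: sub; exists n.
have [N sN] : exists N, s - e < u N.
  apply: contrapT => /forallNP h.
  suff : s <= s - e by rewrite lerBrDr gerDl => /(lt_le_trans e0); rewrite ltxx.
  apply: sle => _ [n _ <-].
  rewrite real_leNgt; first exact/negP/h.
    by rewrite ger0_real.
  by rewrite realB ?ger0_real ?(ltW e0)// (le_trans (u0 0%N)).
exists N => // n /= Nn.
rewrite ger0_norm ?subr_ge0// ltrBlDr -ltrBlDl (lt_le_trans sN)//.
exact: u_nd.
Qed.


Section norm_series.
Variables (V : normedModType K) (u : nat -> V).
Let v : nat -> K := series (fun i => `|u i|).

Let v_nd : nondecreasing_seq v.
Proof.
by apply/nondecreasing_seqP => m; rewrite /v/series/= big_nat_recr//= lerDl.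
Qed.

Let v0 m : 0 <= v m. Proof. by rewrite /v /series/= sumr_ge0. Qed.

Let v_lub : has_ubound (range v) -> isLub (range v) (limn [normed series u]).
Proof.
move=> vub.
have -> : limn [normed series u] = supremum 0 (range v).
  by apply/cvg_lim => //; exact: nondecreasing_cvg_sup.
apply: scalars_sup => //; first by move=> _ [m _ <-].
by exists (v 0%N), 0%N.
Qed.

Lemma norm_series_cvg (M : K) : (forall n, v n <= M) -> cvgn [normed series u].
Proof.
move=> vM; apply/cvg_ex; eexists; apply: (nondecreasing_cvg_sup v_nd v0).
by exists M => _ [n _ <-].
Qed.

Lemma norm_series_le_lim n :
  cvgn [normed series u] -> v n <= limn [normed series u].
Proof.
move=> cu; have [|+ _] := v_lub; last by apply; exists n.
have /cvg_seq_bounded/pinfty_ex_gt0[M M0 vM] := cu.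
exists M => _ [m _ <-]; have := vM m I.
by rewrite /= ger0_norm //; exact: v0.
Qed.

Lemma lim_norm_series_le (M : K) :
  (forall n, v n <= M) -> limn [normed series u] <= M.
Proof.
move=> vM; have [|_] := v_lub; first by exists M => _ [n _ <-].
by apply => _ [n _ <-].
Qed.

End norm_series.

End scalar_sup.

Section dual.
Variables (R : realType) (k : scalar_kind).
Local Notation K := (scalars R k).

Section def.
Variable E : normedModType K.

Definition continuous_functional : {pred E -> K^o} :=
  [pred f : E -> K^o | `[< scalar f /\ continuous f >]].

Record dual := Dual {
  dual_fun :> E -> K^o;
  dual_funP : dual_fun \in continuous_functional }.

HB.instance Definition _ := [isSub for dual_fun].
HB.instance Definition _ := gen_eqMixin dual.
HB.instance Definition _ := gen_choiceMixin dual.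

Lemma continuous_functionalP (f : E -> K^o) :
  reflect (scalar f /\ continuous f) (f \in continuous_functional).
Proof. by apply: (iffP idP) => [/asboolP|?]; [|apply/asboolP]. Qed.

Lemma continuous_functional_submod_closed :
  GRing.submod_closed continuous_functional.
Proof.
split.
  apply/continuous_functionalP; split; last by move=> x; exact: cvg_cst.
  move=> a x y; have h t : (0 : E -> K^o) t = 0 by [].
  by rewrite !h mulr0 addr0.
move=> a f g /continuous_functionalP[fl fc] /continuous_functionalP[gl gc].
apply/continuous_functionalP; split.
  move=> b x y.
  have h t : (a *: f + g) t = a * f t + g t by [].
  by rewrite !h fl gl; ring.
move=> x; apply: cvgD; last exact: gc.
by apply: cvgZr; exact: fc.
Qed.

HB.instance Definition _ := GRing.isSubmodClosed.Build K (E -> K^o)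
  continuous_functional continuous_functional_submod_closed.
HB.instance Definition _ := [SubChoice_isSubLmodule of dual by <:].

Lemma dual_linear (f : dual) : scalar f.
Proof. by have /continuous_functionalP[] := dual_funP f. Qed.

Lemma dual_continuous (f : dual) : continuous f.
Proof. by have /continuous_functionalP[] := dual_funP f. Qed.

Lemma dualDE (f g : dual) (x : E) : (f + g) x = f x + g x.
Proof. by []. Qed.

Lemma dualZE (a : K) (f : dual) (x : E) : (a *: f) x = a * f x.
Proof. by []. Qed.

Lemma dual0 (f : dual) : f 0 = 0.
Proof.
have := dual_linear f 1 0 0; rewrite scaler0 addr0 mul1r => /eqP.
by rewrite -subr_eq0 opprD addNKr oppr_eq0 => /eqP.
Qed.

Lemma dual_scale (f : dual) a x : f (a *: x) = a * f x.
Proof. by have := dual_linear f a x 0; rewrite dual0 !addr0. Qed.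

Definition dual_norm (f : dual) : K :=
  supremum 0 [set `|f x| | x in [set x : E | `|x| <= 1]].

Lemma dual_norm_lub (f : dual) :
  isLub [set `|f x| | x in [set x : E | `|x| <= 1]] (dual_norm f).
Proof.
apply: scalars_sup; first by move=> _ [x _ <-].
  by exists `|f 0|, 0 => //=; rewrite normr0.
pose g : {linear E -> K^o} := HB.pack (f : E -> K^o)
  (GRing.isLinear.Build K E K^o *:%R f (dual_linear f)).
have gc : continuous g by exact: dual_continuous.
have /linear_boundedP/pinfty_ex_gt0[M M0 gM] :=
  continuous_linear_bounded 0 (gc 0).
exists M => _ [x /= x1 <-].
by rewrite (le_trans (gM x))// ler_piMr// ltW.
Qed.

Lemma dual_norm_ge (f : dual) x : `|x| <= 1 -> `|f x| <= dual_norm f.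
Proof. by move=> x1; have [+ _] := dual_norm_lub f; apply; exists x. Qed.

Lemma dual_norm_le (f : dual) M :
  (forall x, `|x| <= 1 -> `|f x| <= M) -> dual_norm f <= M.
Proof. by move=> h; have [_] := dual_norm_lub f; apply => _ [x /= /h ? <-]. Qed.

Lemma dual_norm_ge0 (f : dual) : 0 <= dual_norm f.
Proof. by rewrite (le_trans _ (@dual_norm_ge f 0 _))// normr0. Qed.

Lemma dual_ler_normD (f g : dual) :
  dual_norm (f + g) <= dual_norm f + dual_norm g.
Proof.
apply: dual_norm_le => x x1; rewrite dualDE (le_trans (ler_normD _ _))//.
by rewrite lerD// dual_norm_ge.
Qed.

Let dual_normZ_le (a : K) (f : dual) :
  dual_norm (a *: f) <= `|a| * dual_norm f.
Proof.
apply: dual_norm_le => x x1; rewrite dualZE normrM.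
by rewrite ler_wpM2l// dual_norm_ge.
Qed.

Lemma dual_normZ (a : K) (f : dual) :
  dual_norm (a *: f) = `|a| * dual_norm f.
Proof.
apply/eqP; rewrite eq_le dual_normZ_le/=.
have [->|a0] := eqVneq a 0; first by rewrite normr0 mul0r dual_norm_ge0.
rewrite -ler_pdivlMl ?normr_gt0// -normfV.
by rewrite -{1}(scalerK a0 f) dual_normZ_le.
Qed.

Lemma dual_norm0_eq0 (f : dual) : dual_norm f = 0 -> f = 0.
Proof.
move=> f0; apply: val_inj; apply/funext => x /=.
have [->|x0] := eqVneq x 0; first exact: dual0.
have : `|f (`|x|^-1 *: x)| <= 0.
  by rewrite -f0 dual_norm_ge// normrZ normfV normr_id mulVf// normr_eq0.
rewrite normr_le0 dual_scale mulf_eq0 invr_eq0 normr_eq0 (negbTE x0)/=.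
by move/eqP.
Qed.

HB.instance Definition _ := Lmodule_isNormed.Build K dual
  dual_ler_normD dual_normZ dual_norm0_eq0.

End def.
End dual.

Section weak.
Variables (R : realType) (k : scalar_kind).
Local Notation K := (scalars R k).
Variable E : normedModType K.

(* E with the topology sigma(E, E^* ). *)
Definition weak : Type :=
  initial_topology (fun x : E => (fun f => f x) : {ptws dual E -> K^o}).

HB.instance Definition _ := Topological.on weak.

Definition weakly_compact (A : set E) := compact (A : set weak).

(* The diameter of a bounded set; diam A is the default value 0 when A is
   empty or unbounded. *)
Definition diam (A : set E) : K :=
  supremum 0 [set `|x - y| | x in A & y in A].

Definition state_space (e : E) : set (dual E) :=
  [set f : dual E | `|f| = 1 /\ f e = 1].

End weak.

Section l1.
Variables (R : realType) (k : scalar_kind).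
Local Notation K := (scalars R k).
Variable X : normedModType K.

Definition norm_summable : {pred nat -> X} :=
  [pred x : nat -> X | `[< cvgn [normed series x] >]].

Record l1 := L1 { l1_seq :> nat -> X; l1_seqP : l1_seq \in norm_summable }.

HB.instance Definition _ := [isSub for l1_seq].
HB.instance Definition _ := gen_eqMixin l1.
HB.instance Definition _ := gen_choiceMixin l1.

Lemma norm_summableP (x : nat -> X) :
  reflect (cvgn [normed series x]) (x \in norm_summable).
Proof. exact: asboolP. Qed.

Lemma series_normZ (a : K) (x : nat -> X) n :
  series (fun i => `|a *: x i|) n = `|a| * series (fun i => `|x i|) n.
Proof.
by rewrite /series/= mulr_sumr; apply: eq_bigr => i _; rewrite normrZ.
Qed.

Lemma series_normD (x y : nat -> X) n :
  series (fun i => `|x i + y i|) n <=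
  series (fun i => `|x i|) n + series (fun i => `|y i|) n.
Proof.
by rewrite /series/= -big_split/=; apply: ler_sum => i _; exact: ler_normD.
Qed.

Lemma norm_summable_submod_closed : GRing.submod_closed norm_summable.
Proof.
split.
  apply/norm_summableP; apply: (@norm_series_cvg _ _ _ _ 0) => n.
  by rewrite /series/= big1// => i _; rewrite normr0.
move=> a x y /norm_summableP cx /norm_summableP cy; apply/norm_summableP.
apply: (@norm_series_cvg _ _ _ _
  (`|a| * limn [normed series x] + limn [normed series y])) => n.
rewrite (le_trans (series_normD (a \*: x) y n))// series_normZ.
by rewrite lerD// ?ler_wpM2l// norm_series_le_lim.
Qed.

HB.instance Definition _ := GRing.isSubmodClosed.Build K (nat -> X)
  norm_summable norm_summable_submod_closed.
HB.instance Definition _ := [SubChoice_isSubLmodule of l1 by <:].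

Definition l1_norm (x : l1) : K := limn [normed series x].

Lemma l1_cvg (x : l1) : cvgn [normed series x].
Proof. exact/norm_summableP/l1_seqP. Qed.

Lemma l1_ler_normD (x y : l1) : l1_norm (x + y) <= l1_norm x + l1_norm y.
Proof.
apply: lim_norm_series_le => n; rewrite (le_trans (series_normD x y n))//.
by rewrite lerD// norm_series_le_lim//; exact: l1_cvg.
Qed.

Let l1_normZ_le (a : K) (x : l1) : l1_norm (a *: x) <= `|a| * l1_norm x.
Proof.
apply: lim_norm_series_le => n; rewrite (series_normZ a x).
by rewrite ler_wpM2l// norm_series_le_lim//; exact: l1_cvg.
Qed.

Let norm_le_l1_norm (x : l1) i : `|x i| <= l1_norm x.
Proof.
apply: le_trans (norm_series_le_lim i.+1 (@l1_cvg x)).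
by rewrite /series/= big_nat_recr//= lerDr sumr_ge0.
Qed.

Lemma l1_normZ (a : K) (x : l1) : l1_norm (a *: x) = `|a| * l1_norm x.
Proof.
apply/eqP; rewrite eq_le l1_normZ_le/=.
have [->|a0] := eqVneq a 0.
  by rewrite normr0 mul0r (le_trans _ (norm_le_l1_norm _ 0%N)).
rewrite -ler_pdivlMl ?normr_gt0// -normfV.
by rewrite -{1}(scalerK a0 x) l1_normZ_le.
Qed.

Lemma l1_norm0_eq0 (x : l1) : l1_norm x = 0 -> x = 0.
Proof.
move=> x0; apply: val_inj; apply/funext => i /=.
by have := norm_le_l1_norm x i; rewrite x0 normr_le0 => /eqP.
Qed.

HB.instance Definition _ := Lmodule_isNormed.Build K l1
  l1_ler_normD l1_normZ l1_norm0_eq0.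

End l1.

Section linf.
Variables (R : realType) (k : scalar_kind).
Local Notation K := (scalars R k).
Variable F : normedModType K.

Definition bounded_seq : {pred nat -> F} :=
  [pred f : nat -> F | `[< has_ubound (range (fun i => `|f i|)) >]].

Record linf := Linf {
  linf_seq :> nat -> F;
  linf_seqP : linf_seq \in bounded_seq }.

HB.instance Definition _ := [isSub for linf_seq].
HB.instance Definition _ := gen_eqMixin linf.
HB.instance Definition _ := gen_choiceMixin linf.

Lemma bounded_seqP (f : nat -> F) :
  reflect (exists M, forall i, `|f i| <= M) (f \in bounded_seq).
Proof.
apply: (iffP (asboolP _)) => -[M fM]; exists M.
  by move=> i; apply: fM; exists i.
by move=> _ [i _ <-].
Qed.

Lemma bounded_seq_submod_closed : GRing.submod_closed bounded_seq.
Proof.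
split; first by apply/bounded_seqP; exists 0 => i; rewrite normr0.
move=> a f g /bounded_seqP[M fM] /bounded_seqP[N gN]; apply/bounded_seqP.
exists (`|a| * M + N) => i; rewrite (le_trans (ler_normD _ _))// lerD//.
by rewrite normrZ ler_wpM2l.
Qed.

HB.instance Definition _ := GRing.isSubmodClosed.Build K (nat -> F)
  bounded_seq bounded_seq_submod_closed.
HB.instance Definition _ := [SubChoice_isSubLmodule of linf by <:].

Definition linf_norm (f : linf) : K := supremum 0 (range (fun i => `|f i|)).

Lemma linf_norm_lub (f : linf) :
  isLub (range (fun i => `|f i|)) (linf_norm f).
Proof.
apply: scalars_sup; first by move=> _ [i _ <-].
  by exists `|f 0%N|, 0%N.
by have /bounded_seqP[M fM] := linf_seqP f; exists M => _ [i _ <-].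
Qed.

Lemma linf_norm_ge (f : linf) i : `|f i| <= linf_norm f.
Proof. by have [+ _] := linf_norm_lub f; apply; exists i. Qed.

Lemma linf_norm_le (f : linf) M : (forall i, `|f i| <= M) -> linf_norm f <= M.
Proof. by move=> h; have [_] := linf_norm_lub f; apply => _ [i _ <-]. Qed.

Lemma linf_ler_normD (f g : linf) :
  linf_norm (f + g) <= linf_norm f + linf_norm g.
Proof.
apply: linf_norm_le => i; rewrite (le_trans (ler_normD (f i) (g i)))//.
by rewrite lerD// linf_norm_ge.
Qed.

Let linf_normZ_le (a : K) (f : linf) :
  linf_norm (a *: f) <= `|a| * linf_norm f.
Proof.
apply: linf_norm_le => i; rewrite (normrZ a (f i)).
by rewrite ler_wpM2l// linf_norm_ge.
Qed.

Lemma linf_normZ (a : K) (f : linf) :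
  linf_norm (a *: f) = `|a| * linf_norm f.
Proof.
apply/eqP; rewrite eq_le linf_normZ_le/=.
have [->|a0] := eqVneq a 0.
  by rewrite normr0 mul0r (le_trans _ (linf_norm_ge _ 0%N)).
rewrite -ler_pdivlMl ?normr_gt0// -normfV.
by rewrite -{1}(scalerK a0 f) linf_normZ_le.
Qed.

Lemma linf_norm0_eq0 (f : linf) : linf_norm f = 0 -> f = 0.
Proof.
move=> f0; apply: val_inj; apply/funext => i /=.
by have := linf_norm_ge f i; rewrite f0 normr_le0 => /eqP.
Qed.

HB.instance Definition _ := Lmodule_isNormed.Build K linf
  linf_ler_normD linf_normZ linf_norm0_eq0.

End linf.

Section l1_states.
Variables (R : realType) (k : scalar_kind).
Local Notation K := (scalars R k).
Variable X : normedModType K.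

(* f in l^oo(X^* ) represents the functional e on l^1(X). *)
Definition identified (f : linf (dual X)) (e : dual (l1 X)) : Prop :=
  forall y : l1 X, series (fun i => f i (y i)) @ \oo --> e y.

(* The state space of x, as a subset of l^oo(X^* ). *)
Definition l1_state_space (x : l1 X) : set (linf (dual X)) :=
  [set f | exists2 e : dual (l1 X), state_space x e & identified f e].

End l1_states.

(* Main.v *)
From HB Require Import structures.
Require Import Defs.
From mathcomp Require Import all_boot all_order all_algebra complex lra ring.
From mathcomp Require Import all_classical all_reals all_analysis.
Import Order.TTheory GRing.Theory Num.Theory.
Import numFieldNormedType.Exports.
Local Open Scope classical_set_scope.
Local Open Scope ring_scope.

(* Write S_i for the state space of x_i / ||x_i||.  If f = (f_i) is a state of
   x, then sum_i f_i(x_i) = 1 = sum_i ||x_i|| with |f_i(x_i)| <= ||x_i||, which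
   forces f_i(x_i) = ||x_i||; hence S_x is the product of the S_i inside
   l^oo(X^* ).

   If the S_i are weakly compact and their diameters tend to 0, the
   coordinatewise weak limit of an ultrafilter on the product is a weak limit,
   since a functional on l^oo(X^* ) depends on finitely many coordinates up to
   the norm of the tail.

   Conversely, each S_i is a coordinate of the product, all factors of which are
   nonempty by Hahn-Banach.  If the diameters do not tend to 0, a functional
   f |-> lim_U f_i(u_i), with U a free ultrafilter, separates a sequence in the
   product from its only possible weak cluster point. *)

(** * Limits of scalars along ultrafilters *)

(** For every [A], the ultrafilter contains the preimage of [A] or that of its complement; a proper
    filter finer than the image that contains [A] excludes the second case. *)
Lemma fmap_ultra (T U : Type) (f : T -> U) (F : set_system T) :
  UltraFilter F -> UltraFilter (f @ F).
Proof.
move=> FU; split; first exact: fmap_proper_filter.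
move=> G GP FG; apply/seteqP; split => // A GA.
have [//|FnA] := in_ultra_setVsetC (f @^-1` A) FU.
have /FG GnA : (f @ F) (~` A) by [].
exfalso; apply: (@filter_not_empty _ G GP).
by rewrite -(setICr A); exact: filterI.
Qed.

Lemma real_ultra_cvg (R : realType) (T : Type) (U : set_system T)
    (f : T -> R) (M : R) :
  UltraFilter U -> (forall t, `|f t| <= M) -> exists l : R, f @ U --> l.
Proof.
move=> UU fM; have := @segment_compact R (- M) M; rewrite compact_ultra.
move=> cM.
have [|l [_ fl]] := cM _ (fmap_ultra _ _ f U UU); last by exists l.
by apply: (@filterE _ U) => t /=; rewrite in_itv/= -ler_norml.
Qed.

Lemma norm_cvg_le (K : numFieldType) (V : normedModType K) (T : Type)
    (F : set_system T) (f : T -> V) (l : V) (M : K) :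
  ProperFilter F -> f @ F --> l -> (\forall t \near F, `|f t| <= M) ->
  `|l| <= M.
Proof.
move=> FF fl fM; have [t0 M0] := filter_ex fM.
(* The order of [K] is only partial when [K = R[i]]; knowing that [M] is real allows [<=] to be
   proved by refuting [<]. *)
have Mr : M \is Num.real by rewrite ger0_real// (le_trans _ M0).
rewrite real_leNgt//; apply/negP => Ml.
have /cvgrPdist_lt/(_ (`|l| - M)) := fl; rewrite subr_gt0 => /(_ Ml) flM.
have [t [/= lt tM]] := filter_ex (filterI flM fM).
have : `|l| < `|l|.
  have := ler_normD (l - f t) (f t); rewrite subrK => /le_lt_trans; apply.
  by rewrite -ltrBrDr (lt_le_trans lt)// lerB.
by rewrite ltxx.
Qed.

Lemma complex_norm_le (R : realType) (a b : R) :
  `|(a +i* b)%C| <= `|a|%:C%C + `|b|%:C%C.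
Proof.
have -> : (a +i* b)%C = a%:C%C + 'i%C * b%:C%C by simpc.
rewrite (le_trans (ler_normD _ _))// normrM.
by rewrite !normc_def/= !expr0n/= !addr0 add0r expr1n !sqrtr_sqr sqrtr1 mul1r.
Qed.

(** Bounded closed intervals are compact; for complex scalars the limit is assembled from those of
    the real and imaginary parts, both dominated by the modulus. *)
Lemma scalars_ultra_cvg (R : realType) (k : scalar_kind) (T : Type)
    (U : set_system T) (f : T -> scalars R k) (M : scalars R k) :
  UltraFilter U -> (forall t, `|f t| <= M) ->
  exists l : scalars R k, f @ U --> l.
Proof.
case: k f M => f M UU fM /=; first exact: real_ultra_cvg fM.
have fRe t : `|f t| = (complex.Re `|f t|)%:C%C by rewrite normc_def.
have fMR t : complex.Re `|f t| <= complex.Re M.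
  by have := fM t; rewrite lecE => /andP[].
have [t|a fa] :=
  real_ultra_cvg R T U (fun t => complex.Re (f t)) (complex.Re M) UU.
  apply: le_trans (fMR t); case: (f t) => x y; rewrite normc_def/=.
  by rewrite -sqrtr_sqr ler_wsqrtr// lerDl sqr_ge0.
have [t|b fb] :=
  real_ultra_cvg R T U (fun t => complex.Im (f t)) (complex.Re M) UU.
  apply: le_trans (fMR t); case: (f t) => x y; rewrite normc_def/=.
  by rewrite -sqrtr_sqr ler_wsqrtr// lerDr sqr_ge0.
exists (a +i* b)%C.
apply/(@cvgrPdist_lt _ (scalars R ComplexScalars)^o) => e e0.
have eE : e = (complex.Re e)%:C%C.
  by move: e0; case: e => x y; rewrite ltcE/= => /andP[/eqP->].
have eR : 0 < complex.Re e by move: e0; rewrite ltcE => /andP[].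
have e2 : 0 < complex.Re e / 2 by rewrite divr_gt0.
have /cvgrPdist_lt/(_ _ e2) fa' := fa; have /cvgrPdist_lt/(_ _ e2) fb' := fb.
apply: filterS2 fa' fb' => t /= at_ bt.
rewrite eE; move: at_ bt; case: (f t) => x y /= at_ bt.
rewrite (le_lt_trans (complex_norm_le _ _ _))//.
by rewrite -rmorphD ltcR (splitr (complex.Re e)) ltrD.
Qed.

(** * Dual spaces and the weak topology *)

Section functionals.
Context {R : realType} {k : scalar_kind}.
Local Notation K := (scalars R k).

Lemma dual_bound (E : normedModType K) (f : dual E) (x : E) :
  `|f x| <= `|f| * `|x|.
Proof.
have [->|x0] := eqVneq x 0; first by rewrite dual0 !normr0 mulr0.
have x_gt0 : 0 < `|x| by rewrite normr_gt0.
have : `|f (`|x|^-1 *: x)| <= `|f|.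
  by apply: dual_norm_ge; rewrite normrZ normfV normr_id mulVf// normr_eq0.
rewrite dual_scale normrM normfV normr_id mulrC ler_pdivrMr//.
Qed.

Lemma dual_norm_le_bound (E : normedModType K) (f : dual E) (M : K) :
  0 <= M -> (forall x, `|f x| <= M * `|x|) -> `|f| <= M.
Proof.
move=> M0 fM; apply: dual_norm_le => x x1; apply: le_trans (fM x) _.
by rewrite ler_piMr.
Qed.

Lemma dual_add (E : normedModType K) (f : dual E) x y : f (x + y) = f x + f y.
Proof. by have := dual_linear f 1 x y; rewrite scale1r mul1r. Qed.

Lemma dual_sub (E : normedModType K) (f : dual E) x y : f (x - y) = f x - f y.
Proof. by rewrite dual_add -scaleN1r dual_scale mulN1r. Qed.

Lemma dual_of_bound (E : normedModType K) (f : E -> K) (M : K) : 0 <= M ->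
  (forall a x y, f (a *: x + y) = a * f x + f y) ->
  (forall x, `|f x| <= M * `|x|) -> exists e : dual E, forall x, e x = f x.
Proof.
move=> M0 fl fM.
suff fP : (f : E -> K^o) \in @continuous_functional R k E by exists (Dual fP).
apply/continuous_functionalP; split; first exact: fl.
pose g : {linear E -> K^o} := HB.pack (f : E -> K^o)
  (GRing.isLinear.Build K E K^o *:%R f fl).
apply: (@bounded_linear_continuous _ _ _ g); apply/linear_boundedP.
near=> r => x; apply: le_trans (fM x) _; rewrite ler_wpM2r//.
by near: r; apply: nbhs_pinfty_ge; exact: ger0_real.
Unshelve. all: by end_near. Qed.

(** The weak topology is initial for the evaluation map into the topology of pointwise convergence,
    so convergence is tested one functional at a time. *)
Lemma weak_cvgP (E : normedModType K) (F : set_system (weak E)) (x : weak E) :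
  Filter F -> F --> x <-> forall phi : dual E, phi y @[y --> F] --> phi x.
Proof.
move=> FF; pose ev := (fun x : E => (fun f => f x) : {ptws dual E -> K^o}).
have -> : (F --> x) <-> (ev @ F --> ev x).
  split=> [Fx A /(@initial_continuous E _ ev)/Fx//|evFx].
  move=> A /= [_ [[B Bop <-] Bx BA]].
  apply: filterS BA _; apply: evFx; exact: open_nbhs_nbhs.
by split=> [/pointwise_cvgP h phi|h]; [exact: h|apply/pointwise_cvgP].
Qed.

End functionals.

(** * The Hahn-Banach theorem *)

Section hahn_banach.
Context {R : realType} {V : lmodType R}.
Implicit Types (p q : V -> R) (x y : V).

(** Homogeneity is an inequality for positive scalars, the form that passes directly to infima;
    [sublinearZ] recovers the equality. *)
Definition sublinear p := (forall x y, p (x + y) <= p x + p y) /\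
  (forall a x, 0 < a -> p (a *: x) <= a * p x).

Lemma sublinear0 p : sublinear p -> p 0 = 0.
Proof.
move=> [pD pZ]; have := pD 0 0; have := pZ 2^-1 0.
rewrite scaler0 addr0 invr_gt0 ltr0n => /(_ isT) h1 h2; lra.
Qed.

Lemma sublinearZ p a x : sublinear p -> 0 <= a -> p (a *: x) = a * p x.
Proof.
move=> ps; rewrite le_eqVlt => /predU1P[<-|a0].
  by rewrite scale0r mul0r sublinear0.
have [_ pZ] := ps; apply/eqP; rewrite eq_le pZ//=.
rewrite -ler_pdivlMl// -{1}(scale1r x) -(mulVf (lt0r_neq0 a0)) -scalerA.
by apply: pZ; rewrite invr_gt0.
Qed.

Lemma sublinearN p x : sublinear p -> - p (- x) <= p x.
Proof.
move=> ps; have [pD _] := ps.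
by rewrite -subr_ge0 opprK -(sublinear0 _ ps) -{1}(subrr x).
Qed.

(** The witness is the pointwise infimum of the family; [l] keeps it finite, and the last two
    conditions say that the family is sublinear up to a change of index. It serves both for the
    shifts of one functional and for chains. *)
Lemma inf_sublinear (I : Type) (A : set I) (g : I -> V -> R) (l : V -> R) :
  A !=set0 -> (forall i x, A i -> l x <= g i x) ->
  (forall i j x y, A i -> A j ->
    exists2 m, A m & g m (x + y) <= g i x + g j y) ->
  (forall i a x, A i -> 0 < a ->
    exists2 m, A m & g m (a *: x) <= a * g i x) ->
  exists2 q, sublinear q & forall i x, A i -> q x <= g i x.
Proof.
move=> [i0 Ai0] lg gD gZ; pose q x := inf [set g i x | i in A].
have qg i x : A i -> q x <= g i x.
  move=> Ai; apply: ge_inf; last by exists i.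
  by exists (l x) => _ [j Aj <-]; exact: lg.
have qge x M : (forall i, A i -> M <= g i x) -> M <= q x.
  move=> Mg; apply: lb_le_inf; first by exists (g i0 x), i0.
  by move=> _ [i Ai <-]; exact: Mg.
exists q => //; split => [x y|a x a0].
  rewrite -lerBlDr; apply: (qge) => i Ai; rewrite lerBlDr -lerBlDl.
  apply: qge => j Aj; rewrite lerBlDl.
  by have [m Am] := gD i j x y Ai Aj; apply: le_trans; exact: qg.
rewrite -ler_pdivrMl//; apply: (qge) => i Ai; rewrite ler_pdivrMl//.
by have [m Am] := gZ i a x Ai a0; apply: le_trans; exact: qg.
Qed.

(** Take the infimum over [t >= 0] of [p (x + t *: y) - t * p y]: the index [t = 0] gives [q <= p],
    and [t = 1] gives the bound at [- y]. *)
Lemma sublinear_shift p y : sublinear p ->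
  exists q, [/\ sublinear q, forall x, q x <= p x & q (- y) <= - p y].
Proof.
move=> ps; have [pD pZ] := ps.
have [||||q qs qp] := @inf_sublinear R [set t | 0 <= t]
  (fun t x => p (x + t *: y) - t * p y) (fun x => - p (- x)).
- by exists 0 => /=.
(* Finiteness of the infimum: [t * p y = p (t *: y)] is at most [p (x + t *: y) + p (- x)]. *)
- move=> t x /= t0; rewrite lerBrDr addrC -(sublinearZ _ _ _ ps)// lerBlDr.
  by have := pD (x + t *: y) (- x); rewrite addrAC subrr add0r.
- move=> s t x z /= s0 t0; exists (s + t); first exact: addr_ge0.
  have := pD (x + s *: y) (z + t *: y); rewrite addrACA -scalerDl; lra.
- move=> t a x /= t0 a0; exists (a * t); first by rewrite mulr_ge0// ltW.
  by rewrite -scalerA -scalerDr mulrBr mulrA lerB// pZ.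
exists q; split => // [x|].
  by have := qp 0 x (lexx _); rewrite scale0r addr0 mul0r subr0.
have := qp 1 (- y) ler01.
by rewrite scale1r addNr (sublinear0 _ ps) add0r mul1r.
Qed.

Lemma sublinear_minimal p : sublinear p -> exists q,
  [/\ sublinear q, forall x, q x <= p x &
   forall r, sublinear r -> (forall x, r x <= q x) -> r = q].
Proof.
move=> ps; pose T := {q | sublinear q /\ forall x, q x <= p x}.
(* The order is reversed, so that a maximal element for Zorn's lemma is a minimal functional; a
   nonempty chain is bounded by its infimum. *)
pose le_fun (s t : T) := `[< forall x, sval t x <= sval s x >].
have [||||[q [qs qp]] qmin] := @Zorn T le_fun.
- by move=> t; apply/asboolP.
- move=> r s t /asboolP rs /asboolP st; apply/asboolP => x.
  exact: le_trans (st x) (rs x).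
- move=> [s sP] [t tP] /asboolP /= st /asboolP /= ts; apply: eq_exist => /=.
  by apply/funext => x; apply/eqP; rewrite eq_le ts st.
- move=> A Atot; have [[s0 As0]|A0] := pselect (A !=set0); last first.
    exists (exist _ p (conj ps (fun=> lexx _))) => s As.
    by exfalso; apply: A0; exists s.
  have [||||q qs qA] :=
    @inf_sublinear T A (fun s => sval s) (fun x => - p (- x)).
  + by exists s0.
  + move=> [s [ss sp]] x _ /=; apply: le_trans (sublinearN _ x ss).
    by rewrite lerN2.
  + move=> s t x y As At; have [/asboolP st|/asboolP ts] := Atot s t As At.
      exists t => //; have [[tD _] _] := proj2_sig t.
      by apply: le_trans (tD _ _) _; rewrite lerD2r.
    exists s => //; have [[sD _] _] := proj2_sig s.
    by apply: le_trans (sD _ _) _; rewrite lerD2l.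
  + move=> s a x As a0; exists s => //.
    by have [[_ sZ] _] := proj2_sig s; exact: sZ.
  have qp x : q x <= p x.
    by apply: le_trans (qA s0 x As0) _; have [_] := proj2_sig s0; exact.
  by exists (exist _ q (conj qs qp)) => s As; apply/asboolP => x; exact: qA.
exists q; split => // r rs rq.
have rp x : r x <= p x by exact: le_trans (rq x) (qp x).
apply: (congr1 sval (qmin (exist _ r (conj rs rp)) _)).
exact/asboolP.
Qed.

(* A minimal sublinear functional cannot be lowered by [sublinear_shift], so it
   is odd, hence additive. *)
Lemma hahn_banach_at p x0 : sublinear p -> exists f : {linear V -> R^o},
  (forall x, f x <= p x) /\ f x0 = p x0.
Proof.
(* Lowering [p] at [- x0] before minimizing yields [q (- x0) <= - p x0]; once [q] is odd, this reads
   [p x0 <= q x0]. *)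
move=> ps; have [r [rs rp rx0]] := sublinear_shift _ x0 ps.
have [q [qs qr qmin]] := sublinear_minimal _ rs.
have qN y : q (- y) = - q y.
  apply/eqP; rewrite eq_le; have [s [ss sq sy]] := sublinear_shift _ y qs.
  rewrite -{1}(qmin s ss sq) sy/=.
  by have := sublinearN _ (- y) qs; rewrite opprK.
have qD x y : q (x + y) = q x + q y.
  have [qD _] := qs; apply/eqP; rewrite eq_le qD/=.
  by have := qD (x + y) (- y); rewrite addrK qN lerBrDr.
have qZ a x : q (a *: x) = a * q x.
  have [a0|/ltW a0] := leP 0 a; first exact: sublinearZ.
  apply: oppr_inj; rewrite -qN -scaleNr -mulNr.
  by apply: sublinearZ => //; rewrite oppr_ge0.
have ql : linear (q : V -> R^o) by move=> a x y; rewrite qD qZ.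
pose f : {linear V -> R^o} := HB.pack (q : V -> R^o)
  (GRing.isLinear.Build R V R^o *:%R q ql).
exists f; split => [x|]; first exact: le_trans (qr x) (rp x).
apply/eqP; rewrite eq_le; apply/andP; split.
  exact: le_trans (qr x0) (rp x0).
by have := le_trans (qr (- x0)) rx0; rewrite qN lerN2.
Qed.

End hahn_banach.

(** * States of unit vectors, over real and complex scalars *)

Lemma complex_Re_le_norm (R : realType) (z : R[i]) (M : R) :
  `|z| <= M%:C%C -> complex.Re z <= M.
Proof.
case: z => x y; rewrite normc_def lecR => /= xyM.
apply: le_trans (ler_norm x) (le_trans _ xyM).
by rewrite -sqrtr_sqr ler_wsqrtr// lerDl sqr_ge0.
Qed.

(** The disc of radius [M] about 0 meets the half-plane of real part at least [M] only at the point
    [M]. *)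
Lemma complex_eq_norm (R : realType) (z : R[i]) (M : R) :
  `|z| <= M%:C%C -> M <= complex.Re z -> z = M%:C%C.
Proof.
move=> zM Mz; have := complex_Re_le_norm _ _ _ zM.
move: z zM Mz => [x y]; rewrite normc_def lecR/= => xyM Mx xM.
have M0 : 0 <= M by apply: le_trans xyM; exact: sqrtr_ge0.
have xE : x = M by apply/eqP; rewrite eq_le xM Mx.
have : Num.sqrt (x ^+ 2 + y ^+ 2) ^+ 2 <= M ^+ 2.
  by rewrite ler_pXn2r// nnegrE sqrtr_ge0.
rewrite sqr_sqrtr ?addr_ge0 ?sqr_ge0// xE gerDl => y2.
have /eqP := le_anti (introT andP (conj y2 (sqr_ge0 y))).
by rewrite sqrf_eq0 => /eqP ->.
Qed.

(** The disc of radius [r] about 0 and the disc of radius [1 - r] about 1 touch only at [r]. *)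
Lemma norm_split_eq (R : realType) (k : scalar_kind) (a r : scalars R k) :
  0 <= r -> r <= 1 -> `|a| <= r -> `|1 - a| <= 1 - r -> a = r.
Proof.
case: k a r => /= a r r0 r1 ar; last first.
  have rE : r = (complex.Re r)%:C%C.
    by move: r0; case: (r) => x y; rewrite lecE/= => /andP[/eqP-> _].
  rewrite rE -(rmorph1 (real_complex R)) -rmorphB/= => h.
  apply: complex_eq_norm; first by rewrite -rE.
  have := complex_Re_le_norm _ _ _ h.
  by move: {h ar} a => [x y]/=; rewrite lerD2l lerN2.
move=> h; have := ler_norm a; have := ler_norm (1 - a) => h1 h2.
by apply/eqP; rewrite eq_le; apply/andP; split; lra.
Qed.

Lemma state_of_bound (R : realType) (k : scalar_kind)
    (X : normedModType (scalars R k)) (x : X) (f : X -> scalars R k) :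
  (forall a y z, f (a *: y + z) = a * f y + f z) ->
  (forall y, `|f y| <= `|y|) -> `|x| = 1 -> f x = 1 ->
  state_space x !=set0.
Proof.
move=> fl fb x1 fx.
have [|g gf] := dual_of_bound X f _ ler01 fl; first by move=> y; rewrite mul1r.
exists g; split; last by rewrite gf.
apply/eqP; rewrite eq_le; apply/andP; split.
  by apply: dual_norm_le_bound => // y; rewrite mul1r gf.
by have := dual_bound X g x; rewrite gf fx x1 normr1 mulr1.
Qed.

(** Restriction of scalars; the separate name carries the real module structure beside the complex
    one. *)
Definition realified (R : realType) (X : lmodType R[i]) : Type := X.

Section realified_lmodule.
Context {R : realType} {X : lmodType R[i]}.

HB.instance Definition _ := GRing.Zmodule.on (realified R X).

Let scale (a : R) (x : realified R X) : realified R X := a%:C%C *: (x : X).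

Let scaleA a b x : scale a (scale b x) = scale (a * b) x.
Proof. by rewrite /scale scalerA rmorphM. Qed.

Let scale1 : left_id 1 scale.
Proof. by move=> x; rewrite /scale rmorph1 scale1r. Qed.

Let scaleDr : right_distributive scale +%R.
Proof. by move=> a x y; rewrite /scale -scalerDr. Qed.

Let scaleDl x : {morph scale^~ x : a b / a + b}.
Proof. by move=> a b; rewrite /scale rmorphD -scalerDl. Qed.

HB.instance Definition _ := GRing.Zmodule_isLmodule.Build R (realified R X)
  scaleA scale1 scaleDr scaleDl.

Lemma realified_scale (a : R) (x : realified R X) : a *: x = a%:C%C *: (x : X).
Proof. by []. Qed.

End realified_lmodule.

Lemma state_space_real (R : realType)
    (X : normedModType (scalars R RealScalars)) (x : X) :
  `|x| = 1 -> state_space x !=set0.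
Proof.
move=> x1; have [|f [fle fx]] := hahn_banach_at (V := X) (fun y => `|y| : R) x.
  by split => [y z|a y a0]; rewrite ?ler_normD// normrZ gtr0_norm.
apply: (state_of_bound _ RealScalars X x (f : X -> R)) => //.
- by move=> a y z; rewrite linearP.
- move=> y; rewrite ler_norml fle andbT lerNl -linearN.
  by apply: le_trans (fle _) _; rewrite normrN.
- by rewrite fx.
Qed.

Lemma state_space_complex (R : realType)
    (X : normedModType (scalars R ComplexScalars)) (x : X) :
  `|x| = 1 -> state_space x !=set0.
Proof.
move=> x1; pose V := realified R X; pose nrm (y : X) : R := complex.Re `|y|.
have nrmE (y : X) : `|y| = (nrm y)%:C%C.
  have : 0 <= `|y| by [].
  by rewrite /nrm; case: `|y| => a b; rewrite lecE/= => /andP[/eqP-> _].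
have nrmD (y z : X) : nrm (y + z) <= nrm y + nrm z.
  by rewrite -lecR rmorphD/= -!nrmE ler_normD.
have nrmZ (a : R[i]) (y : X) : (nrm (a *: y))%:C%C = `|a| * (nrm y)%:C%C.
  by rewrite -!nrmE normrZ.
have [|f [fle fx]] := hahn_banach_at (V := V) nrm x.
  split => [y z|a y a0]; first exact: nrmD.
  rewrite -lecR realified_scale nrmZ rmorphM normc_def/= expr0n addr0.
  by rewrite sqrtr_sqr gtr0_norm.
pose fR (y : X) : R := f y.
have fD y z : fR (y + z) = fR y + fR z by exact: linearD.
have fC a b y : fR ((a +i* b)%C *: y) = a * fR y + b * fR ('i%C *: y).
  have -> : (a +i* b)%C = a%:C%C + b%:C%C * 'i%C by simpc.
  by rewrite scalerDl -scalerA fD /fR -!realified_scale !linearZ.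
(* This is the complex-linear functional whose real part is [fR]. *)
pose g (y : X) : R[i] := (fR y -i* fR ('i%C *: y))%C.
have gl (a : R[i]) (y z : X) : g (a *: y + z) = a * g y + g z.
  rewrite /g scalerDr scalerA !fD.
  case: a => a b; rewrite (fC a).
  have -> : 'i%C * (a +i* b)%C = ((- b) +i* a)%C by simpc.
  rewrite (fC (- b)); simpc; congr (_ +i* _)%C; ring.
have gZ (a : R[i]) (y : X) : g (a *: y) = a * g y.
  have g0 : g 0 = 0.
    have := gl 1 0 0.
    by rewrite scale1r mul1r addr0 -{1}(addr0 (g 0)) => /addrI.
  by rewrite -(addr0 (a *: y)) gl g0 addr0.
have gle (y : X) : `|g y| <= `|y|.
  have [->|gy0] := eqVneq (g y) 0; first by rewrite normr0.
  have ngy0 : `|g y| != 0 by rewrite normr_eq0.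
  (* [w] is unimodular and [g (w *: y) = `|g y|] is real *)
  pose w := `|g y| / g y.
  have gw : g (w *: y) = `|g y| by rewrite gZ divfK.
  have nw : `|w| = 1 by rewrite normrM normfV normr_id divff.
  rewrite -gw -(mul1r `|y|) -nw -normrZ nrmE.
  have -> : g (w *: y) = (fR (w *: y))%:C%C.
    have : (complex.Im (g (w *: y))) = 0 by rewrite gw normc_def.
    by rewrite /g /= => ->.
  by rewrite lecR; exact: fle.
apply: (state_of_bound _ ComplexScalars X x g) => //.
(* The value [g x] has modulus at most 1 and real part [f x = 1]. *)
rewrite -(rmorph1 (real_complex R)); apply: complex_eq_norm.
  by rewrite rmorph1 -x1.
by rewrite /= /fR fx /nrm x1.
Qed.

Lemma state_space_neq0 (R : realType) (k : scalar_kind)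
    (X : normedModType (scalars R k)) (x : X) :
  `|x| = 1 -> state_space x !=set0.
Proof.
by case: k X x => X x; [exact: state_space_real|exact: state_space_complex].
Qed.

(** * The state space of l^1(X) as a product *)

Section l1_states_product.
Context {R : realType} {k : scalar_kind}.
Local Notation K := (scalars R k).

Lemma normed_series_cvg (a : nat -> K) (M : K) :
  (forall n, series (fun i => `|a i|) n <= M) ->
  exists l : K, series a @ \oo --> l.
Proof.
move=> aM; pose v : nat -> K := series (fun i => `|a i|).
have vB m n : (n <= m)%N -> `|series a m - series a n| <= v m - v n.
  move=> nm; rewrite /v !sub_series nm; exact: ler_norm_sum.
have v_nd : nondecreasing_seq v.
  by move=> n m nm; rewrite -subr_ge0 (le_trans _ (vB m n nm)).
have v0 n : 0 <= v n by rewrite /v/series/= sumr_ge0.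
have vub : has_ubound (range v) by exists M => _ [n _ <-]; exact: aM.
pose s := supremum 0 (range v).
have vs : v @ \oo --> (s : K) by exact: nondecreasing_cvg_sup.
have v_le n : v n <= s.
  have [|||+ _] := @scalars_sup R k (range v) => //.
  - by move=> _ [m _ <-].
  - by exists (v 0%N), 0%N.
  - by apply; exists n.
(* A free ultrafilter supplies a candidate for the sum; the tail estimate [vB] then upgrades
   convergence along [U] to convergence of the sequence. *)
have [U [UU UN]] := ultraFilterLemma (_ : ProperFilter (\oo : set_system nat)).
have [|l sl] := scalars_ultra_cvg R k nat U (series a) M UU.
  by move=> n; apply: le_trans (aM n); exact: ler_norm_sum.
exists l; apply/cvgrPdist_lt => e e0.
have /cvgrPdist_lt/(_ e e0) := vs; apply: filterS => n /=.
rewrite ger0_norm ?subr_ge0//; apply: le_lt_trans.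
have : (series a m - series a n) @[m --> U] --> l - series a n.
  by apply: cvgB => //; exact: cvg_cst.
move/norm_cvg_le; apply; apply: UN; exists n => // m /= nm.
by rewrite (le_trans (vB m n nm))// lerB.
Qed.

Context {X : normedModType K}.

Lemma l1_series_le (y : l1 X) n : series (fun i => `|y i|) n <= `|y|.
Proof. by apply: norm_series_le_lim; exact: l1_cvg. Qed.

Lemma l1_norm_le (y : l1 X) (M : K) :
  (forall n, series (fun i => `|y i|) n <= M) -> `|y| <= M.
Proof. exact: lim_norm_series_le. Qed.

Let single_series (i : nat) (v : X) n :
  series (fun j => `|if j == i then v else 0|) n <= `|v|.
Proof.
rewrite /series/= (eq_bigr (fun j => if j == i then `|v| else 0)); last first.
  by move=> j _; case: ifP => //; rewrite normr0.
by rewrite -big_mkcond/= big_nat1_eq; case: ifP.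
Qed.

Lemma l1_single (i : nat) (v : X) : exists2 y : l1 X, `|y| <= `|v| &
  forall j, y j = if j == i then v else 0.
Proof.
have yP : (fun j => if j == i then v else 0) \in @norm_summable R k X.
  apply/norm_summableP; apply: norm_series_cvg; exact: single_series.
by exists (L1 yP) => //; apply: l1_norm_le; exact: single_series.
Qed.

(** Testing on the sequence whose only entry is [v] at index [i] transfers norm bounds from [e] to
    the coordinates of [f]. *)
Lemma identified_apply (f : linf (dual X)) (e : dual (l1 X)) i v :
  identified f e -> exists2 y : l1 X, `|y| <= `|v| & f i v = e y.
Proof.
move=> fe; have [y yv yE] := l1_single i v; exists y => //.
have /= := fe y; have : series (fun j => f j (y j)) @ \oo --> (f i v : K).
  (* A partial sum up to [n] omits the index [n], so the term of index [i] is present from [i.+1]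
     on. *)
  apply: cvg_near_cst; exists i.+1 => // n /= ni.
  rewrite /series/= (eq_bigr (fun j => if j == i then f i v else 0)).
    by rewrite -big_mkcond/= big_nat1_eq ni.
  by move=> j _; rewrite yE; case: eqP => [->//|_]; rewrite dual0.
by move=> h1 h2; apply: (cvg_unique (@norm_hausdorff _ _) h1 h2).
Qed.

Lemma state_space_normalizeP (v : X) (g : dual X) : v != 0 ->
  state_space (`|v|^-1 *: v) g <-> `|g| <= 1 /\ g v = `|v|.
Proof.
move=> v0; have nv0 : `|v| != 0 by rewrite normr_eq0.
split=> [[g1 gv]|[g1 gv]].
  split; first by rewrite g1.
  by apply: (mulfI (invr_neq0 nv0)); rewrite -dual_scale gv mulVf.
have gv1 : g (`|v|^-1 *: v) = 1 by rewrite dual_scale gv mulVf.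
split => //; apply/eqP; rewrite eq_le g1/=.
have := dual_bound X g (`|v|^-1 *: v).
by rewrite gv1 normr1 normrZ normfV normr_id mulVf// mulr1.
Qed.

Lemma l1_state_spaceP (x : l1 X) (f : linf (dual X)) : `|x| = 1 ->
  (forall i, `|x i| != 0) ->
  l1_state_space x f <-> forall i, state_space (`|x i|^-1 *: x i) (f i).
Proof.
move=> x1 x0; have xi0 i : x i != 0 by rewrite -normr_eq0.
split=> [[e [e1 ex] fe] i|fS].
  apply/state_space_normalizeP => //.
  have fj1 j : `|f j| <= 1.
    apply: dual_norm_le_bound => // v; rewrite mul1r.
    have [y yv ->] := identified_apply _ _ j v fe; apply: le_trans yv.
    by apply: le_trans (dual_bound _ _ _) _; rewrite e1 mul1r.
  have fx j : `|f j (x j)| <= `|x j|.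
    by rewrite (le_trans (dual_bound _ _ _))// ler_piMl.
  split => //.
  have xi1 : `|x i| <= 1.
    rewrite -x1; apply: le_trans (l1_series_le x i.+1).
    by rewrite /series/= big_nat_recr//= lerDr sumr_ge0.
  (* It remains to bound [1 - f i (x i)], the sum of the other terms, by [1 - |x i|]; this is done
     on partial sums. *)
  apply: norm_split_eq => //.
  have : (series (fun j => f j (x j)) n - f i (x i)) @[n --> \oo] -->
      (1 - f i (x i) : K).
    by rewrite -ex; apply: cvgB; [exact: fe|exact: cvg_cst].
  move/norm_cvg_le; apply; exists i.+1 => // n /= ni.
  have iI : i \in index_iota 0 n by rewrite mem_index_iota ni.
  rewrite lerBrDl -x1; apply: le_trans (l1_series_le x n).
  rewrite /series/= !(bigD1_seq i)//= ?iota_uniq//.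
  rewrite lerD2l (addrC _ (- _)) addKr (le_trans (ler_norm_sum _ _ _))//.
  by apply: ler_sum => j _; exact: fx.
have fxE i : f i (x i) = `|x i| by have /state_space_normalizeP[]// := fS i.
have f1 i v : `|f i v| <= `|v|.
  have /state_space_normalizeP[//|fi1 _] := fS i.
  by rewrite (le_trans (dual_bound _ _ _))// ler_piMl.
have fs (y : l1 X) n : series (fun i => `|f i (y i)|) n <= `|y|.
  by apply: le_trans (l1_series_le y n); apply: ler_sum.
(* The functional represented by [f] sends [y] to the sum of this series, which converges absolutely
   with bound [|y|]. *)
have /choice[e eE] (y : l1 X) :=
  normed_series_cvg (fun i => f i (y i)) _ (fs y).
have [||y|g gE] := dual_of_bound (l1 X) e 1.
- exact: ler01.
- move=> a y z; apply: (cvg_unique (@norm_hausdorff _ _) (eE (a *: y + z))).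
  rewrite (_ : series _ = fun n => a * series (fun i => f i (y i)) n +
    series (fun i => f i (z i)) n); last first.
    apply/funext => n; rewrite /series/= mulr_sumr -big_split/=.
    by apply: eq_bigr => i _; rewrite dual_linear.
  apply: cvgD; last exact: eE.
  by apply: cvgMr; exact: eE.
- rewrite mul1r; have := eE y; move/norm_cvg_le; apply.
  apply: nearW => n; apply: le_trans (fs y n); exact: ler_norm_sum.
have gx : g x = 1.
  rewrite gE -x1; apply: (cvg_unique (@norm_hausdorff _ _) (eE x)).
  rewrite (_ : (fun i => _) = (fun i => `|x i|)); last exact/funext.
  exact: l1_cvg.
exists g; last by move=> y; rewrite gE; exact: eE.
split => //; apply/eqP; rewrite eq_le; apply/andP; split.
  apply: dual_norm_le_bound => // y; rewrite mul1r gE.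
  have := eE y; move/norm_cvg_le; apply.
  apply: nearW => n; apply: le_trans (fs y n); exact: ler_norm_sum.
by have := dual_bound _ g x; rewrite gx x1 normr1 mulr1.
Qed.

End l1_states_product.

(** * Weak convergence in l^oo *)

Section linf_weak.
Context {R : realType} {k : scalar_kind}.
Local Notation K := (scalars R k).
Context {F : normedModType K}.

Lemma linf_of_bound (f : nat -> F) (M : K) :
  (forall i, `|f i| <= M) -> exists g : linf F, forall i, g i = f i.
Proof.
move=> fM; suff fP : f \in @bounded_seq R k F by exists (Linf fP).
by apply/bounded_seqP; exists M.
Qed.

Lemma linf_eq (f g : linf F) : (forall i, f i = g i) -> f = g.
Proof. by move=> fg; apply/val_inj/funext. Qed.

Lemma linfDE (f g : linf F) i : (f + g) i = f i + g i. Proof. by []. Qed.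

Lemma linfZE a (f : linf F) i : (a *: f) i = a *: f i. Proof. by []. Qed.

Lemma linfBE (f g : linf F) i : (f - g) i = f i - g i. Proof. by []. Qed.

Lemma linf_coord_le (f : linf F) i : `|f i| <= `|f|.
Proof. exact: linf_norm_ge. Qed.

Lemma linf_coord_dual i (psi : dual F) :
  exists phi : dual (linf F), forall f, phi f = psi (f i).
Proof.
apply: (dual_of_bound _ _ `|psi|) => // [a f g|f].
  by rewrite linfDE linfZE dual_linear.
by rewrite (le_trans (dual_bound _ _ _))// ler_wpM2l// linf_coord_le.
Qed.

Lemma linf_single_dual i (phi : dual (linf F)) : exists psi : dual F,
  forall v (g : linf F), (forall j, g j = if j == i then v else 0) ->
  phi g = psi v.
Proof.
have h v : exists g : linf F, forall j, g j = if j == i then v else 0.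
  apply: (linf_of_bound _ `|v|) => j; case: ifP => // _.
  by rewrite normr0.
have /choice[s sE] := h.
have [|||psi psiE] := dual_of_bound F (phi \o s) `|phi| => //=.
- move=> a u v; rewrite -dual_linear; congr (phi _); apply: linf_eq => j.
  by rewrite linfDE linfZE !sE; case: ifP => // _; rewrite scaler0 addr0.
- move=> v; apply: le_trans (dual_bound _ _ _) _; rewrite ler_wpM2l//.
  by apply: linf_norm_le => j; rewrite sE; case: ifP => // _; rewrite normr0.
exists psi => v g gE; rewrite psiE /=; congr (phi _); apply: linf_eq => j.
by rewrite sE gE.
Qed.

(* Each functional on l^oo is controlled by finitely many coordinates up to the
   norm of the tail. *)
Lemma linf_weak_cvg (G : set_system (linf F)) (f : linf F) : Filter G ->
  (forall i (psi : dual F), psi (g i) @[g --> G] --> psi (f i)) ->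
  (forall e : K, 0 < e -> exists N, \forall g \near G,
    forall i, (N <= i)%N -> `|(g : linf F) i - f i| <= e) ->
  (G : set_system (weak (linf F))) --> (f : weak (linf F)).
Proof.
move=> GG coord tail; apply/weak_cvgP => phi.
have h N (g : linf F) : exists g' : linf F,
    forall i, g' i = if (i < N)%N then g i else 0.
  apply: (linf_of_bound _ `|g|) => i; case: ifP => _; last by rewrite normr0.
  exact: linf_coord_le.
have [head headE] : exists head : nat -> linf F -> linf F,
    forall N g i, head N g i = if (i < N)%N then g i else 0.
  by exists (fun N => projT1 (choice (h N))) => N; case: choice.
(* Truncations converge by induction: each step adds one coordinate, on which [phi] acts as a
   functional on [F]. *)
have head_cvg N : phi (head N g) @[g --> G] --> (phi (head N f) : K).
  elim: N => [|N IH].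
    have head0 g : head 0%N g = 0 by apply: linf_eq => i; rewrite headE.
    rewrite head0 (_ : (fun g => _) = cst (phi 0)); first exact: cvg_cst.
    by apply/funext => g; rewrite head0.
  have [psi psiE] := linf_single_dual N phi.
  have headS g : phi (head N.+1 g) = phi (head N g) + psi (g N).
    have sE i : (head N.+1 g - head N g) i = if i == N then g N else 0.
      rewrite linfBE !headE ltnS; case: ltngtP => [_|_|->]; rewrite ?subrr//.
      by rewrite subr0.
    by rewrite -(psiE _ _ sE) dual_sub addrC subrK.
  rewrite headS (_ : (fun g => _) = fun g => phi (head N g) + psi (g N)).
    by apply: cvgD => //; exact: coord.
  by apply/funext => g; rewrite headS.
apply/cvgrPdist_lt => e e0; have e2 : 0 < e / 2 by rewrite divr_gt0.
have p1 : 0 < `|phi| + 1 by rewrite ltr_wpDl.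
(* The tail tolerance is divided by [|phi| + 1], which is positive even for [phi = 0], so that [phi]
   of the tail is at most [e / 2]. *)
have [N gN] := tail (e / 2 / (`|phi| + 1)) (divr_gt0 e2 p1).
have /cvgrPdist_lt/(_ _ e2) := head_cvg N.
apply: filterS2 gN => g gN hN.
rewrite (_ : phi f - phi g = phi (head N f) - phi (head N g)
  - phi ((g - f) - (head N g - head N f))); last first.
  by rewrite !dual_sub; ring.
rewrite (le_lt_trans (ler_normB _ _))// (splitr e) ltr_leD//.
rewrite (le_trans (dual_bound _ _ _))//.
apply: (@le_trans _ _ ((`|phi| + 1) * (e / 2 / (`|phi| + 1)))); last first.
  by rewrite mulrC divfK// lt0r_neq0.
apply: ler_pM => //; first by rewrite lerDl.
apply: linf_norm_le => i; rewrite !linfBE !headE.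
case: ltnP => Ni; first by rewrite subrr normr0 divr_ge0// ltW.
by rewrite !subr0; exact: gN.
Qed.

End linf_weak.

(** * Weak compactness of products *)

Section weakly_compact_products.
Context {R : realType} {k : scalar_kind}.
Local Notation K := (scalars R k).

(** Nonemptiness and boundedness exclude the default value 0 of [diam]. *)
Lemma diam_lub (E : normedModType K) (A : set E) (M : K) :
  A !=set0 -> (forall x, A x -> `|x| <= M) ->
  isLub [set `|x - y| | x in A & y in A] (diam A).
Proof.
move=> [a Aa] AM; apply: scalars_sup.
- by move=> _ [y _ [z _ <-]].
- by exists `|a - a|, a => //; exists a.
- exists (M + M) => _ [y Ay [z Az <-]].
  by rewrite (le_trans (ler_normB _ _))// lerD// AM.
Qed.

Lemma diam_ge (E : normedModType K) (A : set E) (M : K) (x y : E) :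
  (forall x, A x -> `|x| <= M) -> A x -> A y -> `|x - y| <= diam A.
Proof.
move=> AM Ax Ay; have [|+ _] := diam_lub E A M _ AM; first by exists x.
by apply; exists x => //; exists y.
Qed.

Lemma diam_gt_exists (E : normedModType K) (A : set E) (M e : K) :
  A !=set0 -> (forall x, A x -> `|x| <= M) -> 0 <= e -> ~~ (diam A <= e) ->
  exists x y, [/\ A x, A y & e < `|x - y|].
Proof.
move=> A0 AM e0 /negP dA; apply: contrapT => h; apply: dA.
have [_] := diam_lub E A M A0 AM; apply => _ [y Ay [z Az <-]].
rewrite real_leNgt ?normr_real ?ger0_real//; apply/negP => yz.
by apply: h; exists y, z.
Qed.

Lemma state_space_norm (E : normedModType K) (v : E) (f : dual E) :
  state_space v f -> `|f| <= 1.
Proof. by move=> [->]. Qed.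

Lemma dual_gt_exists (E : normedModType K) (f : dual E) (e : K) : 0 <= e ->
  e < `|f| -> exists2 u, `|u| <= 1 & e < `|f u|.
Proof.
move=> e0 ef; apply: contrapT => h; move: ef; apply/negP.
rewrite -real_leNgt ?ger0_real//; apply: dual_norm_le => u u1.
rewrite real_leNgt ?ger0_real//; apply/negP => fu; apply: h; by exists u.
Qed.

Lemma dual_eval (X : normedModType K) (v : X) :
  exists ev : dual (dual X), forall p, ev p = p v.
Proof.
by apply: (dual_of_bound _ _ `|v|) => // p; rewrite mulrC dual_bound.
Qed.

(** Bounded scalars always have a limit along [U], and uniqueness of limits makes it linear in [f].
    For free [U] it ignores any finite set of coordinates. *)
Lemma ultra_limit_dual (X : normedModType K) (U : set_system nat)
    (u : nat -> X) :
  UltraFilter U -> (forall i, `|u i| <= 1) ->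
  exists phi : dual (linf (dual X)), forall f : linf (dual X),
    f i (u i) @[i --> U] --> (phi f : K).
Proof.
move=> UU u1.
have fu1 (f : linf (dual X)) i : `|f i (u i)| <= `|f|.
  rewrite (le_trans (dual_bound _ _ _))// (le_trans _ (linf_coord_le f i))//.
  by rewrite ler_piMr.
have fcvg (f : linf (dual X)) := scalars_ultra_cvg R k nat U _ _ UU (fu1 f).
have [l lE] := choice fcvg.
have [|||phi phiE] := dual_of_bound (linf (dual X)) l 1.
- exact: ler01.
- move=> a f g; apply: (cvg_unique (@norm_hausdorff _ _) (lE (a *: f + g))).
  rewrite (_ : (fun i => _) = fun i => a * f i (u i) + g i (u i)); last first.
    by apply/funext => i; rewrite linfDE linfZE dualDE dualZE.
  apply: cvgD; last exact: lE.
  by apply: cvgMr; exact: lE.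
- move=> f; rewrite mul1r; have := lE f; move/norm_cvg_le; apply.
  exact: nearW.
by exists phi => f; rewrite phiE.
Qed.

Section product.
Context {X : normedModType K}.
Variable S : nat -> set (dual X).
Hypothesis S_neq0 : forall i, S i !=set0.
Hypothesis S_norm : forall i f, S i f -> `|f| <= 1.

Let prod : set (linf (dual X)) := [set f | forall i, S i (f i)].

Let prod_of (c : nat -> dual X) : (forall i, S i (c i)) ->
  exists2 f : linf (dual X), prod f & forall i, f i = c i.
Proof.
move=> Sc; have [i|f fE] := linf_of_bound c 1; first exact: S_norm (Sc i).
by exists f => // i; rewrite fE.
Qed.

Lemma prod_weakly_compact : (forall i, weakly_compact (S i)) ->
  diam (S i) @[i --> \oo] --> (0 : K) -> weakly_compact prod.
Proof.
move=> Sc Sd; rewrite /weakly_compact compact_ultra => G GU GS.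
have lim i : exists f : dual X, S i f /\
    forall psi : dual (dual X), psi (g i) @[g --> G] --> psi f.
  have := Sc i; rewrite /weakly_compact compact_ultra => /(_ _
    (fmap_ultra _ (weak (dual X)) (fun g : linf (dual X) => g i) G GU)).
  case=> [|f [Sf]]; first by apply: (@filterS _ G) GS => g; exact.
  by move=> /weak_cvgP Gf; exists f; split => // psi; exact: Gf.
have [c cE] := choice lim.
have [f Sf fE] := prod_of c (fun i => proj1 (cE i)).
exists f; split => //; apply: linf_weak_cvg => [i psi|e e0].
  by rewrite fE; exact: (cE i).2.
have /cvgrPdist_lt/(_ e e0)[N _ Ne] := Sd; exists N.
apply: filterS GS => g Sg i Ni; have := Ne i Ni; rewrite /= sub0r normrN => d_e.
apply: le_trans (ltW d_e).
(* Both [g i] and [f i] lie in [S i], so the diameter controls the tail uniformly in [g]. *)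
apply: le_trans (diam_ge _ _ _ _ _ (S_norm i) (Sg i) (Sf i)) _.
rewrite ger0_norm//.
exact: le_trans (diam_ge _ _ _ _ _ (S_norm i) (Sf i) (Sf i)).
Qed.

(** An ultrafilter on [S i] is carried into the product by inserting [v] at index [i] of a fixed
    point [c]; coordinate [i] of a weak limit there is a weak limit in [S i]. *)
Lemma coord_weakly_compact i : weakly_compact prod -> weakly_compact (S i).
Proof.
rewrite /weakly_compact !compact_ultra => cP G GU GS.
have [c cS] := choice S_neq0.
have h v : exists g : linf (dual X), forall j, g j = if j == i then v else c j.
  apply: (linf_of_bound _ (1 + `|v|)) => j; case: ifP => _.
    by rewrite lerDr.
  by rewrite (le_trans (S_norm _ _ (cS j)))// lerDl.
have [ins insE] := choice h.
have [|f [Pf]] := cP _ (fmap_ultra _ (weak (linf (dual X))) ins G GU).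
  by apply: (@filterS _ G) GS => v Sv j; rewrite insE; case: eqP => [->|].
move=> /weak_cvgP Gf; exists (f i); split; first exact: Pf.
apply/weak_cvgP => psi; have [phi phiE] := linf_coord_dual i psi.
have := Gf phi; rewrite phiE; apply: cvg_trans; apply: near_eq_cvg.
by apply: nearW => v /=; rewrite phiE insE eqxx.
Qed.

(* If the diameters do not tend to 0, there are [y, z] in the product and
   vectors [u i] in the unit ball with [`|(z i - y i) (u i)|] bounded away from 0
   on a set of a free ultrafilter [U].  The sequences equal to [z] up to [n] and
   to [y] after cluster weakly only at [z], while [phi f := lim_U f i (u i)]
   takes the same value at all of them as at [y], and another one at [z]. *)
Lemma weakly_compact_prod_diam : weakly_compact prod ->
  diam (S i) @[i --> \oo] --> (0 : K).
Proof.
rewrite /weakly_compact compact_ultra => cP.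
apply/cvgrPdist_le => e e0; apply: contrapT => nD.
pose D := [set i | ~ `|0 - diam (S i)| <= e].
(* The triple collects [y i], [z i] and [u i]; outside [D] it is filled with equal states and the
   vector 0. *)
have yzu i : exists t : dual X * dual X * X, [/\ S i t.1.1, S i t.1.2,
    `|t.2| <= 1 & D i -> e / 2 < `|(t.1.2 - t.1.1) t.2|].
  have [Di|nDi] := pselect (D i); last first.
    have [f Sf] := S_neq0 i; exists (f, f, 0); split => //=.
    by rewrite normr0.
  have d0 : 0 <= diam (S i).
    have [f Sf] := S_neq0 i.
    by apply: le_trans (diam_ge _ _ _ _ _ (S_norm i) Sf Sf).
  have [|z [y [Sz Sy zy]]] :=
    diam_gt_exists _ _ _ e (S_neq0 i) (S_norm i) (ltW e0).
    by move: Di; rewrite /D/= sub0r normrN ger0_norm// => /negP.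
  have [||u u1 zyu] := dual_gt_exists _ (z - y) (e / 2).
  - by rewrite divr_ge0// ltW.
  - apply: lt_trans zy; rewrite ltr_pdivrMr// ltr_pMr// ltr1n//.
  by exists (y, z, u).
have [t tE] := choice yzu.
have [|y Sy yE] := prod_of (fun i => (t i).1.1).
  by move=> i; have [] := tE i.
have [|z Sz zE] := prod_of (fun i => (t i).1.2).
  by move=> i; have [] := tE i.
pose u i := (t i).2.
have u1 i : `|u i| <= 1 by have [] := tE i.
have Dzy i : D i -> e / 2 < `|z i (u i) - y i (u i)|.
  by move=> Di; rewrite yE zE; have [_ _ _ /(_ Di)] := tE i.
(* Failure of convergence means that [D] meets every tail, so an ultrafilter can be both free and
   concentrated on [D]. *)
have WF : ProperFilter (within D (\oo : set_system nat)).
  apply: Build_ProperFilter_ex => P [N _ NP]; apply: contrapT => nP; apply: nD.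
  exists N => // i Ni /=; apply: contrapT => Di; apply: nP.
  by exists i; exact: NP.
have [U [UU WU]] := ultraFilterLemma WF.
have UD : U D by apply: WU; exists 0%N.
have UN N : U [set i | (N <= i)%N] by apply: WU; exists N.
have [phi phiE] := ultra_limit_dual X U u UU u1.
have h n : exists f : linf (dual X), prod f /\
    forall i, f i = if (i < n)%N then z i else y i.
  have [|f Sf fE] := prod_of (fun i => if (i < n)%N then z i else y i).
    by move=> i; case: ifP.
  by exists f.
have [f fE] := choice h.
have [|g [Pg]] := cP _ (fmap_ultra _ (weak (linf (dual X))) f U UU).
  by apply: (@filterE _ U) => n; exact: (fE n).1.
move=> /weak_cvgP Gf.
(* For fixed [i] and [v], the value of [f n] at coordinate [i] and vector [v] is that of [z] as soon
   as [n > i], which determines the limit. *)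
have gz : g = z.
  apply: linf_eq => i; apply/val_inj/funext => v.
  have [ev evE] := dual_eval X v; have [psi psiE] := linf_coord_dual i ev.
  have zv : psi (f n) @[n --> U] --> (z i v : K).
    apply: cvg_near_cst; apply: filterS (UN i.+1) => n /= ni.
    by rewrite psiE evE (fE n).2 ni.
  apply: (etrans (y := psi g)); first by rewrite psiE evE.
  exact: (cvg_unique (@norm_hausdorff _ _) (Gf psi) zv).
have phi_yz : phi y = phi z :> K.
  have phi_f n : phi (f n) = phi y.
    apply: (cvg_unique (@norm_hausdorff _ _) (phiE (f n))).
    have := phiE y; apply: cvg_trans; apply: near_eq_cvg.
    by apply: filterS (UN n) => i /= ni; rewrite (fE n).2 ltnNge ni.
  apply/esym; rewrite -{1}gz.
  apply: (cvg_unique (@norm_hausdorff _ _) (Gf phi)).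
  by apply: cvg_near_cst; apply: (@filterE _ U) => n; exact: phi_f.
(* These differences tend to 0 along [U], yet exceed [e / 2] in modulus on [D], a set of [U]. *)
have : z i (u i) - y i (u i) @[i --> U] --> (phi z - phi y : K).
  by apply: cvgB; exact: phiE.
rewrite phi_yz subrr => /cvgrPdist_lt/(_ (e / 2)).
rewrite divr_gt0// => /(_ isT) zy.
have [i [Di /=]] := filter_ex (filterI UD zy).
by rewrite sub0r normrN => /(lt_trans (Dzy i Di)); rewrite ltxx.
Qed.

End product.
End weakly_compact_products.

Theorem theorem3p14 (R : realType) (k : scalar_kind)
    (X : completeNormedModType (scalars R k)) (x : l1 X)
    (x_norm1 : `|x| = 1) (x_neq0 : forall i : nat, `|x i| != 0) :
  weakly_compact (l1_state_space x) <->
  (forall i : nat, weakly_compact (state_space (`|x i|^-1 *: x i))) /\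
  diam (state_space (`|x i|^-1 *: x i)) @[i --> \oo] --> (0 : scalars R k).
Proof.
pose S i := state_space (`|x i|^-1 *: x i).
have S_neq0 i : S i !=set0.
  by apply: state_space_neq0; rewrite normrZ normfV normr_id mulVf.
have S_norm i f : S i f -> `|f| <= 1 by exact: state_space_norm.
have -> : l1_state_space x = [set f | forall i, S i (f i)].
  by apply/seteqP; split => f; rewrite /= l1_state_spaceP.
split=> [cS|[cS dS]]; last exact: prod_weakly_compact.
split=> [i|]; first exact: (coord_weakly_compact _ S_neq0 S_norm).
exact: (weakly_compact_prod_diam _ S_neq0 S_norm).
Qed.
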